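(* The ratio $Z(2n)/Z(n)$, as $n$ ranges over the positive integers, is not bounded above.
   Context: For a positive integer $m$ let $T(m) = m(m+1)/2$ denote the $m$-th triangular number. The pseudo-Smarandache function is defined for positive integers $n$ by $Z(n) = \min\{ m \ge 1 : n \mid T(m) \}$. *)

(* Defs.v *)
From mathcomp Require Import all_boot.

Set Implicit Arguments.
Unset Strict Implicit.
Unset Printing Implicit Defensive.

Definition triangular (m : nat) : nat := (m * (m + 1)) %/ 2.

Lemma pseudo_smarandache_ex (n : nat) :
  exists m, (0 < m) && (n.+1 %| triangular m).
Proof.
exists (n.*2.+1); rewrite /triangular addn1 -doubleS -[n.+1.*2]muln2 mulnA mulnK //.
exact: dvdn_mull.
Qed.

(* The value at 0 is a default: 0 divides no T(m) with m >= 1. *)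
Definition pseudo_smarandache (n : nat) : nat :=
  if n is n'.+1 then ex_minn (pseudo_smarandache_ex n') else 0.

Lemma pseudo_smarandacheP (n : nat) (n_gt0 : 0 < n) :
  [/\ 0 < pseudo_smarandache n,
      n %| triangular (pseudo_smarandache n)
    & forall m, 0 < m -> n %| triangular m -> pseudo_smarandache n <= m].
Proof.
case: n n_gt0 => // n _ /=; case: ex_minnP => m /andP[m_gt0 dvd_m] min_m.
by split=> // k k_gt0 dvd_k; apply: min_m; rewrite k_gt0.
Qed.

(* Main.v *)
Require Import Defs.
From mathcomp Require Import all_boot all_order all_algebra.
From mathcomp Require Import cyclic zify.

(** Let [p] be a prime with [p - 1 = 2^k c], [c] odd, and put
    [n = 2^(k-1) p].  Then [2n] divides [(p-1)p], so [Z(n) <= p - 1].  On the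
    other hand [4n = 2^(k+1) p] divides [M (M+1)] only if each of the coprime
    factors [2^(k+1)] and [p] divides [M] or [M + 1]; as [p] is [1] modulo
    [2^k] but not modulo [2^(k+1)], this forces [M >= (2^k - 1) p].  Hence
    [Z(2n)/Z(n) >= 2^k - 1].  Finally [k] can be made arbitrarily large by
    taking for [p] a prime factor of a Fermat number. *)

Import Order.TTheory GRing.Theory Num.Theory.

Lemma dvdn_triangular (n m : nat) :
  (n %| triangular m) = (2 * n %| m * m.+1).
Proof.
rewrite /triangular addn1 [2 * n]mulnC.
have dvd2 : 2 %| m * m.+1 by rewrite dvdn2 oddM /= andbN.
by rewrite dvdn_divRL.
Qed.

(** One of [m] and [m.+1] is odd, hence coprime to [2 ^ k], so the whole power falls on the
    other. *)
Lemma exp2_dvd_mul_succ (k m : nat) :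
  2 ^ k %| m * m.+1 -> (2 ^ k %| m) || (2 ^ k %| m.+1).
Proof.
case: (boolP (odd m)) => m_odd.
  by rewrite Gauss_dvdr ?coprimeXl ?coprime2n // => ->; rewrite orbT.
by rewrite Gauss_dvdl ?coprimeXl ?coprime2n // => ->.
Qed.

(** Modulo [x.+1], [x] is -1, and so is each of its odd powers. *)
Lemma dvdn_succ_exp_odd (x c : nat) : odd c -> x.+1 %| (x ^ c).+1.
Proof.
move=> c_odd; have -> : c = (c./2).*2.+1 by rewrite -{1}(odd_double_half c) c_odd.
case: x => [|x]; first exact: dvd1n.
elim: (c./2) => [|i IHi]; first by rewrite expn1.
rewrite doubleS 2!expnS; move: IHi; move: (x.+1 ^ _) => y IHi.
(* With X = [x.+1], adding (X + 1)(X - 1) = X^2 - 1 turns X^2 y + 1 into X^2 (y + 1). *)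
rewrite -(@dvdn_addl (x.+2 * x)) ?dvdn_mulr //.
have -> : (x.+1 * (x.+1 * y)).+1 + x.+2 * x = x.+1 * x.+1 * y.+1 by lia.
by rewrite dvdn_mull.
Qed.

(* If [k <= j], raising [2^(2^j) = -1] (mod [p]) to the odd power [c] would
   contradict Fermat's little theorem, since [p - 1] divides [2^j c]. *)
Lemma exists_prime_high_exp2 (j : nat) :
  exists p k c : nat, [/\ prime p, j < k, odd c & p = (2 ^ k * c).+1].
Proof.
pose F := (2 ^ 2 ^ j).+1; pose p := pdiv F.
have F_gt1 : 1 < F by rewrite ltnS expn_gt0.
have p_pr : prime p by apply: pdiv_prime.
have p_dvd : p %| F by apply: pdiv_dvd.
have p_odd : odd p.
  by apply: dvdn_odd p_dvd _; rewrite /F /= oddX /= negb_or -lt0n expn_gt0.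
have p1_gt0 : 0 < p.-1 by have := prime_gt1 p_pr; case: (p) => [|[]].
have [c c_cop p1E] := pfactor_coprime (isT : prime 2) p1_gt0.
have c_odd : odd c by rewrite -coprime2n.
exists p, (logn 2 p.-1), c; split => //; last first.
  by rewrite mulnC -p1E prednK ?prime_gt0.
rewrite ltnNge; apply/negP => le_kj.
have one : 2 ^ (2 ^ j * c) = 1 %[mod p].
  have -> : 2 ^ j * c = p.-1 * 2 ^ (j - logn 2 p.-1).
    by rewrite {1}p1E -mulnA -expnD subnKC // mulnC.
  rewrite expnM -modnXm -[X in 2 ^ X](totient_prime p_pr) Euler_exp_totient ?coprime2n //.
  by rewrite modnXm exp1n.
have p_dvd2 : p %| (2 ^ (2 ^ j * c)).+1.
  apply: dvdn_trans p_dvd _.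
  by rewrite expnM dvdn_succ_exp_odd.
(* The same power of 2 is both 1 and -1 modulo [p], so [p] divides 2, although it is odd. *)
move: p_dvd2; rewrite /dvdn -addn1 -modnDml one modnDml.
rewrite -/(dvdn p 2) dvdn_prime2 // => /eqP pE.
by rewrite pE in p_odd.
Qed.

Section Bounds.

Variables p k c : nat.
Hypotheses (p_pr : prime p) (c_odd : odd c) (pE : p = (2 ^ k.+1 * c).+1).

(** In this section [k.+1] stands for the exponent k of the overview. *)
Lemma pseudo_smarandache_le : pseudo_smarandache (2 ^ k * p) <= p.-1.
Proof.
have n_gt0 : 0 < 2 ^ k * p by rewrite muln_gt0 expn_gt0 (prime_gt0 p_pr).
have [_ _] := pseudo_smarandacheP n_gt0; apply.
  by rewrite pE /= muln_gt0 expn_gt0 (odd_gt0 c_odd).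
rewrite dvdn_triangular (prednK (prime_gt0 p_pr)) mulnA -expnS.
by rewrite dvdn_mul // pE /= dvdn_mulr.
Qed.

Lemma pseudo_smarandache_double_ge :
  (2 ^ k.+1).-1 * p <= pseudo_smarandache (2 * (2 ^ k * p)).
Proof.
have n_gt0 : 0 < 2 * (2 ^ k * p) by rewrite !muln_gt0 expn_gt0 (prime_gt0 p_pr).
have [] := pseudo_smarandacheP n_gt0; move: (pseudo_smarandache _) => M M_gt0.
rewrite dvdn_triangular => dvdM _.
have p_gt0 := prime_gt0 p_pr.
have dvd2 : (2 ^ k.+2 %| M) || (2 ^ k.+2 %| M.+1).
  apply: exp2_dvd_mul_succ; apply: dvdn_trans _ dvdM.
  by rewrite !expnS !mulnA dvdn_mulr.
have dvdp : (p %| M) || (p %| M.+1).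
  by rewrite -Euclid_dvdM //; apply: dvdn_trans _ dvdM; rewrite !mulnA dvdn_mull.
have cop : coprime (2 ^ k.+2) p by rewrite coprimeXl // coprime2n pE /= oddM oddX.
have q_gt0 : 0 < 2 ^ k.+1 by rewrite expn_gt0.
have qE : 2 ^ k.+2 = 2 * 2 ^ k.+1 by rewrite expnS.
have q_dvd : 2 ^ k.+1 %| 2 ^ k.+2 by rewrite qE dvdn_mull.
have M_ge t : 2 ^ k.+1 <= t -> M.+1 = t * p -> (2 ^ k.+1).-1 * p <= M.
  move=> t_ge ME; rewrite -ltnS ME; apply: leq_trans (leq_mul t_ge (leqnn p)).
  by rewrite ltn_pmul2r // prednK.
case/orP: dvdp => /dvdnP [s sE]; case/orP: dvd2 => dvd2.
- move: dvd2; rewrite sE Gauss_dvdl // => /dvdn_leq s_ge.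
  rewrite leq_mul2r; apply/orP; right.
  have : 0 < s by case: (s) sE M_gt0 => // ->.
  by move/s_ge; lia.
(* Since [p] is 1 modulo [2 ^ k.+1], [M.+1] = s p + 1 is congruent to [s.+1]. *)
- have : 2 ^ k.+1 %| s.+1.
    rewrite -(@dvdn_addr (s * (2 ^ k.+1 * c))); last by rewrite mulnCA dvdn_mulr.
    rewrite -[X in _ %| X]/(_ + _) addnS -mulnSr -pE -sE.
    exact: dvdn_trans q_dvd dvd2.
  move/dvdn_leq => /(_ isT) s_ge.
  by rewrite sE leq_mul2r; apply/orP; right; lia.
(* The multiplier 1 would give M = p - 1, excluded modulo [2 ^ k.+2] because [c] is odd. A
   multiplier [s.+2] makes M congruent to [s.+1] modulo [2 ^ k.+1]. *)
- case: s sE => [|[|s]] // sE.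
    move: dvd2; have -> : M = 2 ^ k.+1 * c by lia.
    by rewrite qE mulnC dvdn_pmul2l // dvdn2 c_odd.
  have : 2 ^ k.+1 %| s.+1.
    rewrite -(@dvdn_addr (s.+2 * (2 ^ k.+1 * c))); last by rewrite mulnCA dvdn_mulr.
    have -> : s.+2 * (2 ^ k.+1 * c) + s.+1 = M by lia.
    exact: dvdn_trans q_dvd dvd2.
  move/dvdn_leq => /(_ isT) s_ge.
  by apply: M_ge sE; lia.
(* As [2 ^ k.+2] is coprime to [p], it divides the multiplier [s], which is nonzero because [M.+1]
   is. *)
- move: dvd2; rewrite sE Gauss_dvdl // => /dvdn_leq s_ge.
  have : 0 < s by case: (s) sE.
  move/s_ge; rewrite qE => {}s_ge.
  by apply: M_ge sE; lia.
Qed.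

End Bounds.

Local Open Scope ring_scope.

Theorem theorem3 (R : archiRealFieldType) :
  ~ exists B : R, forall n : nat, (0 < n)%N ->
      (pseudo_smarandache (2 * n)%N)%:R / (pseudo_smarandache n)%:R <= B.
Proof.
case=> B ratio_le.
have B_lt := truncnS_gt B; set N := (Num.truncn B).+1 in B_lt.
have [p [[|k] [c [p_pr lt_Nk c_odd pE]]]] := exists_prime_high_exp2 N => //.
have n_gt0 : (0 < 2 ^ k * p)%N by rewrite muln_gt0 expn_gt0 (prime_gt0 p_pr).
have Z_le := pseudo_smarandache_le _ _ _ p_pr c_odd pE.
have Z_ge := pseudo_smarandache_double_ge _ _ _ p_pr c_odd pE.
have [Z_gt0 _ _] := pseudo_smarandacheP n_gt0.
have N_le : (N <= (2 ^ k.+1).-1)%N.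
  by rewrite -ltnS prednK ?expn_gt0 //; apply: ltn_trans lt_Nk (ltn_expl _ _).
have: N%:R <= B.
  apply: le_trans (ratio_le _ n_gt0).
  rewrite ler_pdivlMr ?ltr0n // -natrM ler_nat.
  (* Weakening Z(n) <= p - 1 to Z(n) <= p lets the factor [p] of the lower bound cancel. *)
  apply: leq_trans Z_ge; apply: leq_mul => //.
  exact: leq_trans Z_le (leq_pred p).
by rewrite leNgt B_lt.
Qed.
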